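(* Let $\omega_1,\omega_2\in\mathbb C$ be nonzero with $\omega_1/\omega_2\notin\mathbb R$. If $f:\mathbb C\to\mathbb C$ is an entire function that is elliptic on the lattice $\Lambda=\{a\omega_1+b\omega_2: a,b\in\mathbb Z\}$, then $f$ is constant.
   Context: Given nonzero $\omega_1,\omega_2\in\mathbb C$ with $\omega_1/\omega_2\notin\mathbb R$ and $\Lambda=\{a\omega_1+b\omega_2: a,b\in\mathbb Z\}$, a meromorphic function $f$ on $\mathbb C$ is called elliptic (on $\Lambda$) if $f(z+\omega_1)=f(z+\omega_2)=f(z)$ for all $z\in\mathbb C$. *)

(* Defs.v *)
From Stdlib Require Import Reals.
From Coquelicot Require Import Coquelicot.

Open Scope C_scope.

(* Derivative over the field C; without the explicit structures Coquelicot
   could also read C as a real normed space. *)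
Definition complex_differentiable (f : C -> C) (z : C) : Prop :=
  @ex_derive C_AbsRing C_NormedModule f z.

Definition entire (f : C -> C) : Prop :=
  forall z : C, complex_differentiable f z.

Definition holomorphic_at (f : C -> C) (z0 : C) : Prop :=
  locally z0 (complex_differentiable f).

(* Pole of order n >= 1.  Functions are total, so f has some value at z0; it
   is left unconstrained. *)
Definition pole_at (f : C -> C) (z0 : C) : Prop :=
  exists (n : nat) (g : C -> C),
    (1 <= n)%nat /\ holomorphic_at g z0 /\ g z0 <> 0 /\
    locally' z0 (fun z => f z = g z / (z - z0) ^ n).

Definition meromorphic (f : C -> C) : Prop :=
  forall z0 : C, holomorphic_at f z0 \/ pole_at f z0.

(* Ellipticity on the lattice { a w1 + b w2 : a, b in Z }. *)
Definition elliptic (w1 w2 : C) (f : C -> C) : Prop :=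
  meromorphic f /\
  forall z : C, f (z + w1) = f z /\ f (z + w2) = f z.

Lemma entire_meromorphic (f : C -> C) : entire f -> meromorphic f.
Proof.
  intros hf z0; left; unfold holomorphic_at; apply filter_forall; exact hf.
Qed.

(* Main.v *)
(* Replacing [f z] by [f (w1 z)], the periods are [1] and [tau = p + i q] with
   [q <> 0]. Write [f_a s = f (s + i a)] and let [N a] be the integral of
   [|f_a|^2] over a period. The function
   [z => f (z + i a) * conj (f (conj z + i a))] is entire and [1]-periodic, so by
   Goursat's theorem on rectangles its integral over a horizontal period does
   not depend on the height: the inner product of [f_(a+t)] and [f_(a-t)] is
   [N a], whence
     [|| f_(a+t) - f_(a-t) ||^2 = N (a + t) + N (a - t) - 2 N a].
   So [N] is midpoint convex, and it has period [q] because [tau] is a period of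
   [f]. Convexity along the progression of step [q / k] then forces
   [N (a + q / k) = N a], hence [f (z + 2 i q / k) = f z] for every [k >= 1].
   Having arbitrarily small periods, [f] has derivative zero. *)
Require Import Defs.
From Stdlib Require Import Reals Lra Lia Classical IndefiniteDescription.
From Coquelicot Require Import Coquelicot.
Local Open Scope R_scope.

(** * Goursat's theorem for closed forms on rectangles *)

Lemma nested_intervals (a b : nat -> R) :
  (forall n, a n <= a (S n)) -> (forall n, b (S n) <= b n) ->
  (forall n, a n <= b n) -> exists l, forall n, a n <= l <= b n.
Proof.
  intros Ha Hb Hab.
  assert (Ha' : forall n k, a n <= a (n + k)%nat).
  { intros n k; induction k as [|k IH].
    - rewrite Nat.add_0_r; lra.
    - rewrite Nat.add_succ_r; specialize (Ha (n + k)%nat); lra. }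
  assert (Hb' : forall n k, b (n + k)%nat <= b n).
  { intros n k; induction k as [|k IH].
    - rewrite Nat.add_0_r; lra.
    - rewrite Nat.add_succ_r; specialize (Hb (n + k)%nat); lra. }
  assert (Hall : forall n m, a n <= b m).
  { intros n m; apply Rle_trans with (a (n + m)%nat); [apply Ha'|].
    apply Rle_trans with (b (n + m)%nat); [apply Hab|].
    rewrite Nat.add_comm; apply Hb'. }
  destruct (completeness (fun x => exists n, x = a n)) as [l [Hub Hlub]].
  - exists (b O); intros x [n ->]; apply Hall.
  - exists (a O), O; reflexivity.
  - exists l; intros n; split.
    + apply Hub; exists n; reflexivity.
    + apply Hlub; intros x [m ->]; apply Hall.
Qed.

(** A failing rectangle has a failing quarter. Repeated quartering gives nested failing rectangles
    that shrink to a point, which contradicts the local hypothesis there. The number [r] is the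
    scale relative to the sides [h] and [k]. *)
Lemma rectangle_bisection (h k : R) (P : R -> R -> R -> Prop) :
  0 <= h -> 0 <= k ->
  (forall x y r, P x y (r / 2) -> P (x + r / 2 * h) y (r / 2) ->
     P x (y + r / 2 * k) (r / 2) -> P (x + r / 2 * h) (y + r / 2 * k) (r / 2) ->
     P x y r) ->
  (forall x0 y0, exists delta, 0 < delta /\
     forall x y r, 0 < r < delta -> x <= x0 <= x + r * h ->
       y <= y0 <= y + r * k -> P x y r) ->
  forall x y, P x y 1.
Proof.
  intros Hh Hk Hsplit Hloc x0 y0.
  apply NNPP; intros Hbad.
  (* The relation is vacuous at a triple where [P] holds, so it is total and [step] can be chosen on
     all triples. *)
  destruct (functional_choice
    (fun (s t : R * R * R) =>
       let '(x, y, r) := s in let '(x', y', r') := t in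
       ~ P x y r -> r' = r / 2 /\ ~ P x' y' r' /\
         (x' = x \/ x' = x + r / 2 * h) /\ (y' = y \/ y' = y + r / 2 * k)))
    as [step Hstep].
  { intros [[x y] r].
    destruct (classic (P x y (r / 2))) as [H1|H1];
      [|exists (x, y, r / 2); auto].
    destruct (classic (P (x + r / 2 * h) y (r / 2))) as [H2|H2];
      [|exists (x + r / 2 * h, y, r / 2); auto].
    destruct (classic (P x (y + r / 2 * k) (r / 2))) as [H3|H3];
      [|exists (x, y + r / 2 * k, r / 2); auto].
    exists (x + r / 2 * h, y + r / 2 * k, r / 2); intros Hn.
    repeat split; auto. }
  set (s := fix s n := match n with O => (x0, y0, 1) | S n => step (s n) end).
  set (X := fun n => fst (fst (s n))).
  set (Y := fun n => snd (fst (s n))).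
  assert (Hs : forall n, snd (s n) = (/ 2) ^ n /\ ~ P (X n) (Y n) ((/ 2) ^ n)).
  { induction n as [|n [IH1 IH2]]; [split; auto|].
    unfold X, Y in *; simpl.
    specialize (Hstep (s n)).
    destruct (s n) as [[x y] r], (step (x, y, r)) as [[x' y'] r'].
    simpl in *; subst r.
    destruct (Hstep IH2) as (-> & Hn & _ & _).
    replace (/ 2 * (/ 2) ^ n) with ((/ 2) ^ n / 2) by field; auto. }
  assert (HXY : forall n, (X (S n) = X n \/ X (S n) = X n + (/ 2) ^ n / 2 * h) /\
                          (Y (S n) = Y n \/ Y (S n) = Y n + (/ 2) ^ n / 2 * k)).
  { intros n; destruct (Hs n) as [H1 H2].
    unfold X, Y in *; simpl.
    specialize (Hstep (s n)).
    destruct (s n) as [[x y] r], (step (x, y, r)) as [[x' y'] r'].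
    simpl in *; subst r; tauto. }
  assert (Hpos : forall n, 0 < (/ 2) ^ n) by (intros n; apply pow_lt; lra).
  assert (Hnest : forall Z l, 0 <= l ->
    (forall n, Z (S n) = Z n \/ Z (S n) = Z n + (/ 2) ^ n / 2 * l) ->
    exists z, forall n, Z n <= z <= Z n + (/ 2) ^ n * l).
  { intros Z l Hl HZ.
    apply (nested_intervals Z (fun n => Z n + (/ 2) ^ n * l));
      intros n; specialize (Hpos n);
      assert (0 <= (/ 2) ^ n * l) by (apply Rmult_le_pos; lra);
      specialize (HZ n); simpl; lra. }
  destruct (Hnest X h Hh (fun n => proj1 (HXY n))) as [x1 Hx1].
  destruct (Hnest Y k Hk (fun n => proj2 (HXY n))) as [y1 Hy1].
  destruct (Hloc x1 y1) as (delta & Hd & HP).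
  destruct (pow_lt_1_zero (/ 2)) with (y := delta) as [n Hn]; auto.
  { rewrite Rabs_pos_eq; lra. }
  destruct (Hs n) as [_ Hn']; apply Hn'.
  apply HP; auto.
  split; [apply Hpos|].
  specialize (Hn n (Nat.le_refl n)); rewrite Rabs_pos_eq in Hn; auto.
  specialize (Hpos n); lra.
Qed.

Lemma continuity_2d_pt_fst (P : R -> R -> R) (x y : R) :
  continuity_2d_pt P x y -> continuous (fun s => P s y) x.
Proof.
  intros H; apply continuity_pt_filterlim, continuity_pt_locally.
  intros eps; exact (locally_2d_1d_const_y _ _ _ (H eps)).
Qed.

Lemma continuity_2d_pt_snd (P : R -> R -> R) (x y : R) :
  continuity_2d_pt P x y -> continuous (P x) y.
Proof.
  intros H; apply continuity_pt_filterlim, continuity_pt_locally.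
  intros eps; exact (locally_2d_1d_const_x _ _ _ (H eps)).
Qed.

Lemma ex_RInt_continuous_everywhere (f : R -> R) (a b : R) :
  (forall x, continuous f x) -> ex_RInt f a b.
Proof. intros H; apply (ex_RInt_continuous (V := R_CompleteNormedModule)); auto. Qed.

Lemma RInt_Chasles_continuous (f : R -> R) (a b c : R) :
  (forall x, continuous f x) -> RInt f a b + RInt f b c = RInt f a c.
Proof.
  intros H; apply (RInt_Chasles (V := R_CompleteNormedModule));
    apply ex_RInt_continuous_everywhere; auto.
Qed.

Lemma RInt_minus_continuous (f g : R -> R) (a b : R) :
  (forall x, continuous f x) -> (forall x, continuous g x) ->
  RInt (fun x => f x - g x) a b = RInt f a b - RInt g a b.
Proof.
  intros Hf Hg; apply (RInt_minus (V := R_CompleteNormedModule));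
    apply ex_RInt_continuous_everywhere; auto.
Qed.

Definition closed_form (P Q : R -> R -> R) : Prop :=
  forall x y, exists a b c,
    differentiable_pt_lim P x y a b /\ differentiable_pt_lim Q x y b c.

(* Integral of [P dx + Q dy] along the boundary of [[x1, x2] * [y1, y2]]. *)
Definition rectangle_integral (P Q : R -> R -> R) (x1 x2 y1 y2 : R) : R :=
  RInt (fun s => P s y1) x1 x2 - RInt (fun s => P s y2) x1 x2 +
  (RInt (Q x2) y1 y2 - RInt (Q x1) y1 y2).

Lemma closed_form_continuity (P Q : R -> R -> R) (x y : R) :
  closed_form P Q -> continuity_2d_pt P x y /\ continuity_2d_pt Q x y.
Proof.
  intros H; destruct (H x y) as (a & b & c & HP & HQ).
  split; apply differentiable_continuity_pt; do 2 eexists; eassumption.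
Qed.

(** The affine approximation of the form at [(x0, y0)] is closed and integrates to zero. The
    remainder is at most a small multiple of [r] on sides of length of order [r]. *)
Lemma rectangle_integral_local (P Q : R -> R -> R) (h k c x0 y0 : R) :
  closed_form P Q -> 0 <= h -> 0 <= k -> 0 < c ->
  exists delta, 0 < delta /\
    forall x y r, 0 < r < delta -> x <= x0 <= x + r * h ->
      y <= y0 <= y + r * k ->
      Rabs (rectangle_integral P Q x (x + r * h) y (y + r * k)) <= c * r ^ 2.
Proof.
  intros HPQ Hh Hk Hc.
  assert (HcP : forall x y, continuity_2d_pt P x y)
    by (intros; apply (closed_form_continuity _ Q); auto).
  assert (HcQ : forall x y, continuity_2d_pt Q x y)
    by (intros; apply (closed_form_continuity P); auto).
  (* Both coordinate distances to [(x0, y0)] and the sum of the two side lengths are at most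
     [r * m]; the [1] keeps [m] positive. The total error is then [2 * eps * (r * m) ^ 2], which the
     choice of [eps] turns into [c * r ^ 2 / 2]. *)
  set (m := h + k + 1).
  assert (Hm : 0 < m) by (unfold m; lra).
  assert (Heps : 0 < c / (4 * m ^ 2)).
  { apply Rdiv_lt_0_compat; auto.
    apply Rmult_lt_0_compat; [lra|apply pow_lt; auto]. }
  set (eps := mkposreal _ Heps).
  destruct (HPQ x0 y0) as (p & q & q' & HP & HQ).
  destruct (HP eps) as [d1 H1], (HQ eps) as [d2 H2].
  set (d := Rmin d1 d2).
  assert (Hd : 0 < d) by (apply Rmin_pos; apply cond_pos).
  exists (d / m); split; [apply Rdiv_lt_0_compat; auto|].
  intros x y r [Hr Hrd] Hx Hy.
  assert (Hrm : r * m < d).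
  { apply Rmult_lt_compat_r with (r := m) in Hrd; auto.
    replace (d / m * m) with d in Hrd by (field; lra); lra. }
  assert (Hrh : 0 <= r * h) by (apply Rmult_le_pos; lra).
  assert (Hrk : 0 <= r * k) by (apply Rmult_le_pos; lra).
  assert (Hrm' : r * m = r * h + r * k + r) by (unfold m; ring).
  set (e := eps * (r * m)).
  assert (Hest : forall s t, x <= s <= x + r * h -> y <= t <= y + r * k ->
    Rabs (P s t - P x0 y0 - (p * (s - x0) + q * (t - y0))) <= e /\
    Rabs (Q s t - Q x0 y0 - (q * (s - x0) + q' * (t - y0))) <= e).
  { intros s t Hs Ht.
    assert (Hs' : Rabs (s - x0) <= r * m) by (apply Rabs_le; lra).
    assert (Ht' : Rabs (t - y0) <= r * m) by (apply Rabs_le; lra).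
    assert (d <= d1 /\ d <= d2) as [] by (split; [apply Rmin_l|apply Rmin_r]).
    assert (Hmax : eps * Rmax (Rabs (s - x0)) (Rabs (t - y0)) <= e).
    { apply Rmult_le_compat_l; [apply Rlt_le, cond_pos|].
      apply Rmax_lub; auto. }
    split; eapply Rle_trans; try apply Hmax;
      [apply H1|apply H2]; lra. }
  (* On opposite sides the affine parts differ by the constants [- (q * (r * k))] and [q * (r * h)].
     Integrated over lengths [r * h] and [r * k], these cancel. *)
  assert (HIP : Rabs (RInt (fun s => P s y - P s (y + r * k) - - (q * (r * k)))
      x (x + r * h)) <= (x + r * h - x) * (2 * e)).
  { apply abs_RInt_le_const; [lra| |].
    - apply ex_RInt_continuous_everywhere; intros s.
      apply (continuous_minus (V := R_NormedModule));
        [apply (continuous_minus (V := R_NormedModule))|apply continuous_const];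
        apply continuity_2d_pt_fst; auto.
    - intros s Hs.
      destruct (Hest s y) as [Ha _]; [lra..|].
      destruct (Hest s (y + r * k)) as [Hb _]; [lra..|].
      apply Rabs_le_between in Ha; apply Rabs_le_between in Hb.
      apply Rabs_le; lra. }
  assert (HIQ : Rabs (RInt (fun t => Q (x + r * h) t - Q x t - q * (r * h))
      y (y + r * k)) <= (y + r * k - y) * (2 * e)).
  { apply abs_RInt_le_const; [lra| |].
    - apply ex_RInt_continuous_everywhere; intros s.
      apply (continuous_minus (V := R_NormedModule));
        [apply (continuous_minus (V := R_NormedModule))|apply continuous_const];
        apply continuity_2d_pt_snd; auto.
    - intros t Ht.
      destruct (Hest x t) as [_ Ha]; [lra..|].
      destruct (Hest (x + r * h) t) as [_ Hb]; [lra..|].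
      apply Rabs_le_between in Ha; apply Rabs_le_between in Hb.
      apply Rabs_le; lra. }
  assert (HcPs : forall t s, continuous (fun s => P s t) s)
    by (intros; apply continuity_2d_pt_fst; auto).
  assert (HcQt : forall s t, continuous (Q s) t)
    by (intros; apply continuity_2d_pt_snd; auto).
  rewrite RInt_minus_continuous, RInt_minus_continuous, RInt_const in HIP;
    auto; try (intros; apply continuous_const);
    try (intros; apply (continuous_minus (V := R_NormedModule)); auto).
  rewrite RInt_minus_continuous, RInt_minus_continuous, RInt_const in HIQ;
    auto; try (intros; apply continuous_const);
    try (intros; apply (continuous_minus (V := R_NormedModule)); auto).
  unfold rectangle_integral.
  set (I1 := RInt (fun s => P s y) x (x + r * h)).
  set (I2 := RInt (fun s => P s (y + r * k)) x (x + r * h)).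
  set (J1 := RInt (Q x) y (y + r * k)).
  set (J2 := RInt (Q (x + r * h)) y (y + r * k)).
  change (Rabs (I1 - I2 - (x + r * h - x) * - (q * (r * k)))
            <= (x + r * h - x) * (2 * e)) in HIP.
  change (Rabs (J2 - J1 - (y + r * k - y) * (q * (r * h)))
            <= (y + r * k - y) * (2 * e)) in HIQ.
  apply Rle_trans with (r * m * (2 * e)).
  - apply Rabs_le_between in HIP; apply Rabs_le_between in HIQ.
    assert (0 <= r * e).
    { apply Rmult_le_pos; [lra|]; apply Rmult_le_pos;
        [apply Rlt_le, cond_pos|lra]. }
    apply Rabs_le; rewrite Hrm'. lra.
  - unfold e, eps; simpl.
    replace (r * m * (2 * (c / (4 * (m * (m * 1))) * (r * m)))) with (c * r ^ 2 / 2)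
      by (field; lra).
    assert (0 < c * r ^ 2) by (apply Rmult_lt_0_compat; [|apply pow_lt]; lra).
    simpl in *; lra.
Qed.

(** Each inner side is traversed twice, in opposite directions. *)
Lemma rectangle_integral_split (P Q : R -> R -> R) (x1 x2 x3 y1 y2 y3 : R) :
  closed_form P Q ->
  rectangle_integral P Q x1 x3 y1 y3 =
    rectangle_integral P Q x1 x2 y1 y2 + rectangle_integral P Q x2 x3 y1 y2 +
    rectangle_integral P Q x1 x2 y2 y3 + rectangle_integral P Q x2 x3 y2 y3.
Proof.
  intros HPQ; unfold rectangle_integral.
  assert (HcP : forall t s, continuous (fun s => P s t) s)
    by (intros; apply continuity_2d_pt_fst, (closed_form_continuity _ Q); auto).
  assert (HcQ : forall s t, continuous (Q s) t)
    by (intros; apply continuity_2d_pt_snd, (closed_form_continuity P); auto).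
  rewrite <- (RInt_Chasles_continuous (fun s => P s y1) x1 x2 x3),
    <- (RInt_Chasles_continuous (fun s => P s y3) x1 x2 x3),
    <- (RInt_Chasles_continuous (Q x1) y1 y2 y3),
    <- (RInt_Chasles_continuous (Q x3) y1 y2 y3); auto.
  ring.
Qed.

(** The bound [c / 2 * r ^ 2] passes from quarters to the whole, since four times [(r / 2) ^ 2] is
    [r ^ 2]; by bisection it need only be checked locally. The half leaves room for a strict
    inequality. *)
Lemma goursat_rectangle (P Q : R -> R -> R) (x y h k : R) :
  closed_form P Q -> 0 <= h -> 0 <= k ->
  rectangle_integral P Q x (x + h) y (y + k) = 0.
Proof.
  intros HPQ Hh Hk.
  apply cond_eq; intros c Hc; rewrite Rminus_0_r.
  assert (Hc2 : 0 < c / 2) by lra.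
  enough (Rabs (rectangle_integral P Q x (x + 1 * h) y (y + 1 * k))
            <= c / 2 * 1 ^ 2) by (rewrite !Rmult_1_l, pow1 in *; lra).
  revert x y.
  apply (rectangle_bisection h k (fun x y r =>
    Rabs (rectangle_integral P Q x (x + r * h) y (y + r * k)) <= c / 2 * r ^ 2));
    auto.
  - intros x y r H1 H2 H3 H4.
    rewrite (rectangle_integral_split P Q x (x + r / 2 * h) _ y (y + r / 2 * k))
      by auto.
    replace (x + r / 2 * h + r / 2 * h) with (x + r * h) in * by field.
    replace (y + r / 2 * k + r / 2 * k) with (y + r * k) in * by field.
    apply Rabs_le_between in H1, H2, H3, H4.
    apply Rabs_le; simpl in *; lra.
  - intros x0 y0; apply rectangle_integral_local; auto.
Qed.

(** On a rectangle of width one the two vertical sides cancel. *)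
Lemma closed_form_RInt_const (P Q : R -> R -> R) (y1 y2 : R) :
  closed_form P Q -> (forall y, Q 1 y = Q 0 y) ->
  RInt (fun s => P s y1) 0 1 = RInt (fun s => P s y2) 0 1.
Proof.
  intros HPQ Hper.
  enough (Hle : forall y k, 0 <= k ->
            RInt (fun s => P s y) 0 1 = RInt (fun s => P s (y + k)) 0 1).
  { destruct (Rle_dec y1 y2).
    - rewrite (Hle y1 (y2 - y1)), Rplus_minus by lra; reflexivity.
    - symmetry; rewrite (Hle y2 (y1 - y2)), Rplus_minus by lra; reflexivity. }
  intros y k Hk.
  pose proof (goursat_rectangle P Q 0 y 1 k HPQ Rle_0_1 Hk) as H.
  unfold rectangle_integral in H.
  rewrite Rplus_0_l, (RInt_ext (Q 1) (Q 0)) in H by auto.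
  lra.
Qed.

(** * Integrals over a period *)

Lemma RInt_period (f : R -> R) (a : R) :
  (forall x, continuous f x) -> (forall x, f (x + 1) = f x) ->
  RInt f a (a + 1) = RInt f 0 1.
Proof.
  intros Hf Hper.
  assert (Hshift : RInt f 1 (a + 1) = RInt f 0 a).
  { pose proof (RInt_comp_lin (V := R_CompleteNormedModule) f 1 1 0 a) as H.
    replace (1 * 0 + 1) with 1 in H by ring.
    replace (1 * a + 1) with (a + 1) in H by ring.
    rewrite <- H by (apply ex_RInt_continuous_everywhere; auto).
    apply RInt_ext; intros x _.
    change (1 * f (1 * x + 1) = f x); rewrite !Rmult_1_l; auto. }
  pose proof (RInt_Chasles_continuous f 0 a (a + 1) Hf).
  pose proof (RInt_Chasles_continuous f 0 1 (a + 1) Hf).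
  lra.
Qed.

Lemma RInt_shift_period (f : R -> R) (p : R) :
  (forall x, continuous f x) -> (forall x, f (x + 1) = f x) ->
  RInt (fun x => f (x + p)) 0 1 = RInt f 0 1.
Proof.
  intros Hf Hper; rewrite <- (RInt_period f p) by auto.
  pose proof (RInt_comp_lin (V := R_CompleteNormedModule) f 1 p 0 1) as H.
  replace (1 * 0 + p) with p in H by ring.
  replace (1 * 1 + p) with (p + 1) in H by ring.
  rewrite <- H by (apply ex_RInt_continuous_everywhere; auto).
  apply RInt_ext; intros x _.
  change (f (x + p) = 1 * f (1 * x + p)); rewrite !Rmult_1_l; auto.
Qed.

(** The period is centred at [x], so the primitive of [f] vanishes in a neighbourhood of [x], where
    its derivative is [f x]. *)
Lemma RInt_period_eq_0 (f : R -> R) (x : R) :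
  (forall x, continuous f x) -> (forall x, f (x + 1) = f x) ->
  (forall x, 0 <= f x) -> RInt f 0 1 = 0 -> f x = 0.
Proof.
  intros Hf Hper Hpos H0.
  rewrite <- (RInt_period f (x - / 2)) in H0 by auto.
  set (a := x - / 2) in *.
  assert (Hzero : forall t, a <= t <= a + 1 -> RInt f a t = 0).
  { intros t Ht.
    pose proof (RInt_Chasles_continuous f a t (a + 1) Hf).
    assert (0 <= RInt f a t)
      by (apply RInt_ge_0; [lra|apply ex_RInt_continuous_everywhere|]; auto).
    assert (0 <= RInt f t (a + 1))
      by (apply RInt_ge_0; [lra|apply ex_RInt_continuous_everywhere|]; auto).
    lra. }
  assert (Hd : is_derive (RInt f a) x (f x)).
  { apply (is_derive_RInt (V := R_NormedModule) f (RInt f a) a); auto.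
    apply filter_forall; intros t.
    apply (RInt_correct (V := R_CompleteNormedModule)),
      ex_RInt_continuous_everywhere; auto. }
  assert (Hd0 : is_derive (RInt f a) x 0).
  { apply (is_derive_ext_loc (fun _ => 0)).
    - assert (Hhalf : 0 < / 2) by lra.
      exists (mkposreal _ Hhalf); intros t Ht.
      symmetry; apply Hzero.
      change (Rabs (t - x) < / 2) in Ht; apply Rabs_lt_between in Ht.
      unfold a; lra.
    - apply (is_derive_const (V := R_NormedModule)). }
  apply is_derive_unique in Hd; apply is_derive_unique in Hd0; congruence.
Qed.

(** * Doubly periodic solutions of the Cauchy-Riemann equations *)

Lemma differentiable_pt_lim_affine (f : R -> R -> R) (x y a b : R) :
  (forall s t, f s t - f x y = a * (s - x) + b * (t - y)) ->
  differentiable_pt_lim f x y a b.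
Proof.
  intros Hf eps; exists (mkposreal 1 Rlt_0_1); intros s t _ _.
  rewrite Hf, Rminus_diag, Rabs_R0.
  apply Rmult_le_pos; [apply Rlt_le, cond_pos|].
  eapply Rle_trans; [apply Rabs_pos|apply Rmax_l].
Qed.

Lemma differentiable_pt_lim_mult (f g : R -> R -> R) (x y a b c d : R) :
  differentiable_pt_lim f x y a b -> differentiable_pt_lim g x y c d ->
  differentiable_pt_lim (fun s t => f s t * g s t) x y
    (g x y * a + f x y * c) (g x y * b + f x y * d).
Proof.
  intros Hf Hg.
  apply (differentiable_pt_lim_comp (fun s t => s * t) f g); auto.
  (* The remainder of a product is the product of the two increments, so [eps] itself serves as the
     radius. *)
  intros eps; exists eps; intros s t Hs Ht.
  replace (_ - _) with ((s - f x y) * (t - g x y)) by ring.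
  rewrite Rabs_mult; apply Rmult_le_compat; try apply Rabs_pos;
    [lra|apply Rmax_r].
Qed.

Lemma differentiable_pt_lim_plus (f g : R -> R -> R) (x y a b c d : R) :
  differentiable_pt_lim f x y a b -> differentiable_pt_lim g x y c d ->
  differentiable_pt_lim (fun s t => f s t + g s t) x y (a + c) (b + d).
Proof.
  intros Hf Hg.
  replace (a + c) with (1 * a + 1 * c) by ring.
  replace (b + d) with (1 * b + 1 * d) by ring.
  apply (differentiable_pt_lim_comp (fun s t => s + t) f g); auto.
  apply differentiable_pt_lim_affine; intros; ring.
Qed.

(** Serves for [e = 1] and [e = -1], that is, for z + ic and its reflection conj z + ic. *)
Lemma differentiable_pt_lim_comp_snd (f : R -> R -> R) (x y e c a b : R) :
  differentiable_pt_lim f x (c + e * y) a b ->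
  differentiable_pt_lim (fun s t => f s (c + e * t)) x y a (e * b).
Proof.
  intros Hf.
  replace a with (a * 1 + b * 0) by ring.
  replace (e * b) with (a * 0 + b * e) by ring.
  apply (differentiable_pt_lim_comp f (fun s _ => s) (fun _ t => c + e * t));
    auto; apply differentiable_pt_lim_affine; intros; ring.
Qed.

(** The complex derivative of u + iv is a + ib. *)
Definition cauchy_riemann (u v : R -> R -> R) : Prop :=
  forall x y, exists a b,
    differentiable_pt_lim u x y a (- b) /\ differentiable_pt_lim v x y b a.

Lemma cauchy_riemann_continuity (u v : R -> R -> R) (x y : R) :
  cauchy_riemann u v -> continuity_2d_pt u x y /\ continuity_2d_pt v x y.
Proof.
  intros H; destruct (H x y) as (a & b & Hu & Hv).
  split; apply differentiable_continuity_pt; do 2 eexists; eassumption.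
Qed.

(* With [F = u + i v], the form is the real part of [G dz] for the holomorphic
   function [G z = F (z + i c) * conj (F (conj z + i c))]. *)
Lemma closed_form_reflection (u v : R -> R -> R) (c : R) :
  cauchy_riemann u v ->
  closed_form
    (fun x y => u x (c + 1 * y) * u x (c + -1 * y) +
                v x (c + 1 * y) * v x (c + -1 * y))
    (fun x y => u x (c + 1 * y) * v x (c + -1 * y) +
                -1 * (v x (c + 1 * y) * u x (c + -1 * y))).
Proof.
  intros Huv x y.
  destruct (Huv x (c + 1 * y)) as (a & b & Hu & Hv).
  destruct (Huv x (c + -1 * y)) as (a' & b' & Hu' & Hv').
  apply differentiable_pt_lim_comp_snd in Hu, Hv, Hu', Hv'.
  assert (Hm : differentiable_pt_lim (fun _ _ => -1) x y 0 0)
    by (apply differentiable_pt_lim_affine; intros; ring).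
  pose proof (differentiable_pt_lim_plus _ _ _ _ _ _ _ _
    (differentiable_pt_lim_mult _ _ _ _ _ _ _ _ Hu Hu')
    (differentiable_pt_lim_mult _ _ _ _ _ _ _ _ Hv Hv')) as HP.
  pose proof (differentiable_pt_lim_plus _ _ _ _ _ _ _ _
    (differentiable_pt_lim_mult _ _ _ _ _ _ _ _ Hu Hv')
    (differentiable_pt_lim_mult _ _ _ _ _ _ _ _ Hm
      (differentiable_pt_lim_mult _ _ _ _ _ _ _ _ Hv Hu'))) as HQ.
  do 3 eexists; split; [exact HP|].
  (* [HP] has fixed the shared derivative, so the remaining identity is Q_x = P_y, with the
     Cauchy-Riemann equations already substituted. *)
  refine (eq_ind _ (fun l => differentiable_pt_lim _ x y l _) HQ _ _); ring.
Qed.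

(** Both sides are integrals of the reflected closed form over a horizontal period, at heights [t]
    and [0]. *)
Lemma periodic_cauchy_riemann_polarization (u v : R -> R -> R) (c t : R) :
  cauchy_riemann u v ->
  (forall x y, u (x + 1) y = u x y) -> (forall x y, v (x + 1) y = v x y) ->
  RInt (fun s => u s (c + t) * u s (c - t) + v s (c + t) * v s (c - t)) 0 1 =
  RInt (fun s => u s c ^ 2 + v s c ^ 2) 0 1.
Proof.
  intros Huv Hu Hv.
  pose proof (closed_form_RInt_const _ _ t 0
    (closed_form_reflection u v c Huv)) as H.
  etransitivity; [|etransitivity; [apply H|]].
  - apply RInt_ext; intros s _.
    replace (c + 1 * t) with (c + t) by ring.
    replace (c + -1 * t) with (c - t) by ring; reflexivity.
  - intros y.
    assert (Hu0 : forall t, u 1 t = u 0 t)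
      by (intros; rewrite <- (Hu 0), Rplus_0_l; reflexivity).
    assert (Hv0 : forall t, v 1 t = v 0 t)
      by (intros; rewrite <- (Hv 0), Rplus_0_l; reflexivity).
    cbv beta; rewrite !Hu0, !Hv0; reflexivity.
  - apply RInt_ext; intros s _.
    replace (c + 1 * 0) with c by ring.
    replace (c + -1 * 0) with c by ring.
    change (u s c * u s c + v s c * v s c = u s c ^ 2 + v s c ^ 2); ring.
Qed.

(** * Midpoint convexity and small periods *)

(** The increments are nondecreasing and the first [S k] of them sum to zero, so the first one
    cannot be positive. *)
Lemma convex_periodic_sequence (w : nat -> R) (k : nat) :
  (forall n, 2 * w (S n) <= w n + w (S (S n))) -> w (S k) = w O ->
  w 1%nat <= w O.
Proof.
  intros Hconv Hk.
  assert (Hincr : forall n, w 1%nat - w O <= w (S n) - w n).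
  { induction n as [|n IH]; [lra|]; specialize (Hconv n); lra. }
  assert (Hlin : forall n, INR n * (w 1%nat - w O) <= w n - w O).
  { induction n as [|n IH]; [simpl; lra|].
    rewrite S_INR; specialize (Hincr n); lra. }
  specialize (Hlin (S k)); rewrite Hk, Rminus_diag in Hlin.
  pose proof (lt_0_INR (S k) (Nat.lt_0_succ k)).
  apply Rnot_lt_le; intros Hlt.
  assert (0 < INR (S k) * (w 1%nat - w O)) by (apply Rmult_lt_0_compat; lra).
  lra.
Qed.

(** Sampling [N] at step [r / INR (S k)] for a period [r] gives one inequality; the periods [q] and
    [- q] give both. *)
Lemma convex_periodic_const (N : R -> R) (q : R) (k : nat) :
  (forall a t, 2 * N a <= N (a + t) + N (a - t)) ->
  (forall a, N (a + q) = N a) ->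
  forall a, N (a + q / INR (S k)) = N a.
Proof.
  intros Hconv Hper.
  assert (Hle : forall r, (forall a, N (a + r) = N a) ->
            forall a, N (a + r / INR (S k)) <= N a).
  { intros r Hr a.
    pose proof (convex_periodic_sequence
      (fun n => N (a + INR n * (r / INR (S k)))) k) as H.
    cbv beta in H; change (INR 0) with 0 in H; change (INR 1) with 1 in H.
    rewrite Rmult_1_l, Rmult_0_l, Rplus_0_r in H.
    apply H.
    - intros n.
      pose proof (Hconv (a + INR (S n) * (r / INR (S k))) (r / INR (S k))) as Hc.
      replace (a + INR (S n) * (r / INR (S k)) + r / INR (S k))
        with (a + INR (S (S n)) * (r / INR (S k))) in Hc
        by (rewrite (S_INR (S n)); ring).
      replace (a + INR (S n) * (r / INR (S k)) - r / INR (S k))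
        with (a + INR n * (r / INR (S k))) in Hc by (rewrite (S_INR n); ring).
      lra.
    - replace (INR (S k) * (r / INR (S k))) with r
        by (field; apply not_0_INR; lia).
      apply Hr. }
  intros a; apply Rle_antisym; [apply Hle; auto|].
  replace (N a) with (N (a + q / INR (S k) + (- q) / INR (S k)))
    by (f_equal; field; apply not_0_INR; lia).
  apply Hle; intros b.
  rewrite <- (Hper (b + - q)); f_equal; ring.
Qed.

(** With t = q / (k + 1), the heights y and y + 2t are symmetric about y + t, which explains the
    factor 2. [N] agrees at the three heights, so the squared distance between the outer two slices
    is zero. *)
Lemma doubly_periodic_cauchy_riemann_period (u v : R -> R -> R) (p q : R) (k : nat) :
  cauchy_riemann u v ->
  (forall x y, u (x + 1) y = u x y) -> (forall x y, v (x + 1) y = v x y) ->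
  (forall x y, u (x + p) (y + q) = u x y) ->
  (forall x y, v (x + p) (y + q) = v x y) ->
  forall x y, u x (y + 2 * (q / INR (S k))) = u x y /\
              v x (y + 2 * (q / INR (S k))) = v x y.
Proof.
  intros Huv Hu1 Hv1 Hu2 Hv2 x y.
  assert (Hcu : forall y x, continuous (fun s => u s y) x)
    by (intros; apply continuity_2d_pt_fst, (cauchy_riemann_continuity _ v); auto).
  assert (Hcv : forall y x, continuous (fun s => v s y) x)
    by (intros; apply continuity_2d_pt_fst, (cauchy_riemann_continuity u); auto).
  set (N := fun a => RInt (fun s => u s a ^ 2 + v s a ^ 2) 0 1).
  set (D := fun a b s => (u s a - u s b) ^ 2 + (v s a - v s b) ^ 2).
  assert (Hsq : forall f : R -> R, (forall s, continuous f s) ->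
            forall s, continuous (fun s => f s ^ 2) s).
  { intros f Hf s; apply (continuous_ext (fun s => f s * f s)); [intros; simpl; ring|].
    apply (continuous_mult (K := R_AbsRing)); auto. }
  assert (HcN : forall a s, continuous (fun s => u s a ^ 2 + v s a ^ 2) s).
  { intros a s; apply (continuous_plus (V := R_NormedModule)); apply Hsq; auto. }
  assert (HcM : forall a b s, continuous (fun s => u s a * u s b + v s a * v s b) s).
  { intros a b s; apply (continuous_plus (V := R_NormedModule));
      apply (continuous_mult (K := R_AbsRing)); auto. }
  assert (HcD : forall a b s, continuous (D a b) s).
  { intros a b s; apply (continuous_plus (V := R_NormedModule)); apply Hsq;
      intros; apply (continuous_minus (V := R_NormedModule)); auto. }
  assert (HD0 : forall a b s, 0 <= D a b s)
    by (intros; apply Rplus_le_le_0_compat; apply pow2_ge_0).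
  (* Expanding the square leaves a cross term, which polarization identifies with [N a]. *)
  assert (HDN : forall a t,
            RInt (D (a + t) (a - t)) 0 1 = N (a + t) + N (a - t) - 2 * N a).
  { intros a t; unfold N.
    rewrite <- (periodic_cauchy_riemann_polarization u v a t) by auto.
    set (A1 := fun s => u s (a + t) ^ 2 + v s (a + t) ^ 2).
    set (A2 := fun s => u s (a - t) ^ 2 + v s (a - t) ^ 2).
    set (M := fun s => u s (a + t) * u s (a - t) + v s (a + t) * v s (a - t)).
    assert (HcA1 : forall s, continuous A1 s) by apply HcN.
    assert (HcA2 : forall s, continuous A2 s) by apply HcN.
    assert (HcM' : forall s, continuous M s) by apply HcM.
    transitivity (RInt (fun s => (A1 s - M s) - (M s - A2 s)) 0 1).
    - apply RInt_ext; intros s _; unfold D, A1, A2, M.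
      change (@eq R ((u s (a + t) - u s (a - t)) ^ 2 + (v s (a + t) - v s (a - t)) ^ 2)
        (u s (a + t) ^ 2 + v s (a + t) ^ 2 -
         (u s (a + t) * u s (a - t) + v s (a + t) * v s (a - t)) -
         (u s (a + t) * u s (a - t) + v s (a + t) * v s (a - t) -
          (u s (a - t) ^ 2 + v s (a - t) ^ 2)))).
      ring.
    - rewrite !RInt_minus_continuous; auto;
        try (intros; apply (continuous_minus (V := R_NormedModule)); auto).
      change (RInt A1 0 1 - RInt M 0 1 - (RInt M 0 1 - RInt A2 0 1) =
              RInt A1 0 1 + RInt A2 0 1 - 2 * RInt M 0 1); ring. }
  assert (HN : forall a, N (a + q / INR (S k)) = N a).
  { apply convex_periodic_const.
    - intros a t.
      assert (0 <= RInt (D (a + t) (a - t)) 0 1)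
        by (apply RInt_ge_0; [lra|apply ex_RInt_continuous_everywhere|]; auto).
      rewrite HDN in H; lra.
    (* The second period raises the height by [q] and shifts horizontally by [p]; the horizontal
       shift does not change an integral over a full period. *)
    - intros a; unfold N.
      rewrite <- (RInt_shift_period (fun s => u s (a + q) ^ 2 + v s (a + q) ^ 2) p)
        by (first [exact (HcN (a + q)) | intros; rewrite Hu1, Hv1; reflexivity]).
      apply RInt_ext; intros s _; rewrite Hu2, Hv2; auto. }
  set (t := q / INR (S k)) in *.
  assert (HDy : D (y + t + t) (y + t - t) x = 0).
  { apply RInt_period_eq_0; auto.
    - intros s; unfold D; rewrite !Hu1, !Hv1; auto.
    - rewrite HDN, HN.
      replace (y + t - t) with y by ring; rewrite HN.
      change (N y + N y - 2 * N y = 0); ring. }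
  unfold D in HDy.
  replace (y + t - t) with y in HDy by ring.
  replace (y + 2 * t) with (y + t + t) by ring.
  split; apply Rminus_diag_uniq, Rsqr_0_uniq.
  - unfold Rsqr; pose proof (pow2_ge_0 (v x (y + t + t) - v x y)).
    pose proof (pow2_ge_0 (u x (y + t + t) - u x y)); simpl in *; lra.
  - unfold Rsqr; pose proof (pow2_ge_0 (v x (y + t + t) - v x y)).
    pose proof (pow2_ge_0 (u x (y + t + t) - u x y)); simpl in *; lra.
Qed.

(** * From small periods to constancy *)

(** The vertical difference quotients vanish along increments tending to zero. *)
Lemma differentiable_arbitrarily_small_periods (f : R -> R -> R) (x y a b q : R) :
  differentiable_pt_lim f x y a b -> q <> 0 ->
  (forall k, f x (y + 2 * (q / INR (S k))) = f x y) -> b = 0.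
Proof.
  intros Hf Hq Hper.
  apply cond_eq; intros eps Heps; rewrite Rminus_0_r.
  assert (Heps2 : 0 < eps / 2) by lra.
  destruct (Hf (mkposreal _ Heps2)) as [d Hd]; simpl in Hd.
  (* This makes the increment [2 * (q / INR n)] smaller than [d] in absolute value. *)
  destruct (archimed_cor1 (d / (2 * Rabs q))) as (n & Hn & Hn0).
  { apply Rdiv_lt_0_compat; [apply cond_pos|].
    pose proof (Rabs_pos_lt q Hq); lra. }
  destruct n as [|k]; [lia|].
  set (h := 2 * (q / INR (S k))).
  assert (Hk : 0 < INR (S k)) by (apply lt_0_INR; lia).
  assert (Hq' : 0 < Rabs q) by (apply Rabs_pos_lt; auto).
  assert (Hh : Rabs h = 2 * Rabs q * / INR (S k)).
  { unfold h, Rdiv; rewrite !Rabs_mult, Rabs_inv, (Rabs_pos_eq 2),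
      (Rabs_pos_eq (INR (S k))) by lra; ring. }
  assert (Hhpos : 0 < Rabs h).
  { rewrite Hh; apply Rmult_lt_0_compat; [lra|apply Rinv_0_lt_compat; auto]. }
  assert (Hhd : Rabs h < d).
  { rewrite Hh; apply Rmult_lt_compat_l with (r := 2 * Rabs q) in Hn; [|lra].
    replace (2 * Rabs q * (d / (2 * Rabs q))) with (pos d) in Hn by (field; lra).
    auto. }
  specialize (Hd x (y + h)).
  replace (y + h - y) with h in Hd by ring.
  unfold h in Hd at 2; rewrite Hper in Hd; fold h in Hd.
  rewrite !Rminus_diag, Rmult_0_r, Rplus_0_l, Rabs_R0, Rmax_right in Hd by lra.
  rewrite Rminus_0_l, Rabs_Ropp, Rabs_mult in Hd.
  specialize (Hd (cond_pos d) Hhd).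
  apply Rmult_le_reg_r in Hd; lra.
Qed.

Lemma zero_differential_const (f : R -> R -> R) :
  (forall x y, differentiable_pt_lim f x y 0 0) -> forall x y, f x y = f 0 0.
Proof.
  intros Hf.
  assert (Hconst : forall g : R -> R,
            (forall t, derivable_pt_lim g t 0) -> forall t, g t = g 0).
  { intros g Hg t.
    assert (Hg' : forall s, is_derive g s zero)
      by (intros s; apply is_derive_Reals, Hg).
    destruct (Rtotal_order t 0) as [Ht|[->|Ht]]; auto;
      [|symmetry]; apply eq_is_derive; auto. }
  intros x y.
  transitivity (f x 0).
  - apply (Hconst (f x)); intros t.
    pose proof (derivable_pt_lim_comp_2d f (fun _ => x) (fun t => t) t _ _ _ _
      (Hf x t) (derivable_pt_lim_const x t) (derivable_pt_lim_id t)) as H.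
    rewrite !Rmult_0_l, Rplus_0_l in H; exact H.
  - apply (Hconst (fun t => f t 0)); intros t.
    pose proof (derivable_pt_lim_comp_2d f (fun t => t) (fun _ => 0) t _ _ _ _
      (Hf t 0) (derivable_pt_lim_id t) (derivable_pt_lim_const 0 t)) as H.
    rewrite !Rmult_0_l, Rplus_0_l in H; exact H.
Qed.

(** The vertical derivatives [- b] of [u] and [a] of [v] vanish; by the Cauchy-Riemann equations so
    do the horizontal ones. *)
Lemma doubly_periodic_cauchy_riemann_const (u v : R -> R -> R) (p q : R) :
  cauchy_riemann u v -> q <> 0 ->
  (forall x y, u (x + 1) y = u x y) -> (forall x y, v (x + 1) y = v x y) ->
  (forall x y, u (x + p) (y + q) = u x y) ->
  (forall x y, v (x + p) (y + q) = v x y) ->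
  forall x y, u x y = u 0 0 /\ v x y = v 0 0.
Proof.
  intros Huv Hq Hu1 Hv1 Hu2 Hv2.
  assert (Hzero : forall x y, differentiable_pt_lim u x y 0 0 /\
                              differentiable_pt_lim v x y 0 0).
  { intros x y; destruct (Huv x y) as (a & b & Hu & Hv).
    pose proof (fun k => doubly_periodic_cauchy_riemann_period u v p q k
      Huv Hu1 Hv1 Hu2 Hv2 x y) as Hper.
    assert (Hb : - b = 0)
      by (eapply differentiable_arbitrarily_small_periods; eauto; apply Hper).
    assert (Ha : a = 0)
      by (eapply differentiable_arbitrarily_small_periods; eauto; apply Hper).
    rewrite Hb in Hu; replace b with 0 in Hv by lra; subst a; auto. }
  intros x y; split; apply zero_differential_const; apply Hzero.
Qed.

(** * Entire functions and normalization of the lattice *)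

(** The chain rule gives z -> f(wz) the derivative [w * l], whose real and imaginary parts are the
    required coefficients. The factor [w] allows one period to be scaled to 1. *)
Lemma entire_cauchy_riemann (f : C -> C) (w : C) :
  entire f ->
  cauchy_riemann (fun x y => Re (f (w * (x, y))%C))
                 (fun x y => Im (f (w * (x, y))%C)).
Proof.
  intros Hf x y.
  set (z := (x, y) : C).
  destruct (Hf (w * z)%C) as [l [_ Hl]].
  specialize (Hl (w * z)%C (fun P HP => HP)).
  exists (Re (w * l)%C), (Im (w * l)%C).
  (* The modulus of an increment is at most twice its larger coordinate, so multiplication by [w]
     enlarges the maximum norm by at most [M]; the [1] keeps [M] positive. *)
  set (M := 2 * (Cmod w + 1)).
  assert (HM : 0 < M) by (unfold M; pose proof (Cmod_ge_0 w); lra).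
  assert (Hest : forall eps : posreal, locally_2d (fun s t =>
    Cmod (f (w * (s, t)) - f (w * z) - w * ((s, t) - z) * l)%C <=
      eps * Rmax (Rabs (s - x)) (Rabs (t - y))) x y).
  { intros eps.
    assert (He : 0 < eps / M) by (apply Rdiv_lt_0_compat; [apply cond_pos|auto]).
    destruct (Hl (mkposreal _ He)) as [d Hd].
    assert (Hd' : 0 < d / M) by (apply Rdiv_lt_0_compat; [apply cond_pos|auto]).
    exists (mkposreal _ Hd'); simpl; intros s t Hs Ht.
    set (m := Rmax (Rabs (s - x)) (Rabs (t - y))).
    assert (Hm : m < d / M) by (apply Rmax_lub_lt; auto).
    assert (Hm0 : 0 <= m)
      by (eapply Rle_trans; [apply Rabs_pos|apply Rmax_l]).
    assert (Hz : Cmod ((s, t) - z)%C <= 2 * m).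
    { eapply Rle_trans; [apply Cmod_2Rmax|].
      apply Rmult_le_compat_r; [exact Hm0|].
      apply Rsqr_incr_0_var; [|lra].
      rewrite Rsqr_sqrt; unfold Rsqr; lra. }
    assert (Hwz : Cmod (w * (s, t) - w * z)%C <= M * m).
    { replace (w * (s, t) - w * z)%C with (w * ((s, t) - z))%C by ring.
      rewrite Cmod_mult.
      pose proof (Cmod_ge_0 w); pose proof (Cmod_ge_0 ((s, t) - z)%C).
      apply Rle_trans with (Cmod w * (2 * m)).
      - apply Rmult_le_compat_l; auto.
      - unfold M; lra. }
    assert (HMm : M * m < d).
    { apply Rmult_lt_compat_l with (r := M) in Hm; auto.
      replace (M * (d / M)) with (pos d) in Hm by (field; lra); auto. }
    specialize (Hd (w * (s, t))%C (Rle_lt_trans _ _ _ Hwz HMm)).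
    change (Cmod (f (w * (s, t)) - f (w * z) - (w * (s, t) - w * z) * l)%C <=
      eps / M * Cmod (w * (s, t) - w * z)%C) in Hd.
    replace (w * ((s, t) - z) * l)%C with ((w * (s, t) - w * z) * l)%C by ring.
    eapply Rle_trans; [exact Hd|].
    apply Rmult_le_compat_l with (r := eps / M) in Hwz; [|lra].
    replace (eps / M * (M * m)) with (eps * m) in Hwz by (field; lra); auto. }
  (* The remainders of the two components are the real and imaginary parts of the complex remainder,
     each bounded by its modulus. *)
  split; intros eps; destruct (Hest eps) as [d Hd]; exists d;
    intros s t Hs Ht; (eapply Rle_trans; [|apply (Hd s t Hs Ht)]);
    [eapply Rle_trans; [|apply re_le_Cmod]
    |eapply Rle_trans; [|eapply Rle_trans; [apply Rmax_r|apply Rmax_Cmod]]];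
    apply Req_le; f_equal; unfold z, Re, Im, Cminus, Cplus, Cmult, Copp; simpl;
    ring.
Qed.

Theorem theorem2p1 (w1 w2 : C) (hw1 : w1 <> RtoC 0) (hw2 : w2 <> RtoC 0)
    (hw : ~ exists r : R, (w1 / w2)%C = RtoC r)
    (f : C -> C) (hf : entire f) (hell : elliptic w1 w2 f) :
  exists c : C, forall z : C, f z = c.
Proof.
  destruct hell as [_ Hper].
  (* This is the inverse of the ratio in [hw]: a real [tau] would be nonzero and make [w1 / w2] the
     real number [/ Re tau]. *)
  set (tau := (w2 / w1)%C).
  assert (Htau : Im tau <> 0).
  { intros H0; apply hw; exists (/ Re tau).
    assert (Ht : tau = RtoC (Re tau))
      by (destruct tau as [p q]; simpl in *; subst; reflexivity).
    assert (Hre : Re tau <> 0).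
    { intros Hr; rewrite Hr in Ht; apply hw2.
      replace w2 with (tau * w1)%C by (unfold tau; field; auto).
      rewrite Ht; ring. }
    rewrite RtoC_inv, <- Ht; auto.
    unfold tau; field; auto. }
  pose proof (doubly_periodic_cauchy_riemann_const _ _ (Re tau) (Im tau)
    (entire_cauchy_riemann f w1 hf) Htau) as Hconst.
  assert (H1 : forall x y, f (w1 * ((x + 1)%R, y))%C = f (w1 * (x, y))%C).
  { intros x y; rewrite <- (proj1 (Hper (w1 * (x, y))%C)); f_equal.
    replace (((x + 1)%R, y) : C) with ((x, y) + RtoC 1)%C; [ring|].
    unfold Cplus; simpl; f_equal; ring. }
  assert (H2 : forall x y,
            f (w1 * ((x + Re tau)%R, (y + Im tau)%R))%C = f (w1 * (x, y))%C).
  { intros x y; rewrite <- (proj2 (Hper (w1 * (x, y))%C)); f_equal.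
    replace (((x + Re tau)%R, (y + Im tau)%R) : C) with ((x, y) + tau)%C by reflexivity.
    unfold tau; field; auto. }
  exists (f (w1 * (0%R, 0%R))%C); intros z.
  destruct (Hconst (fun x y => f_equal Re (H1 x y)) (fun x y => f_equal Im (H1 x y))
    (fun x y => f_equal Re (H2 x y)) (fun x y => f_equal Im (H2 x y))
    (Re (z / w1)%C) (Im (z / w1)%C)) as [Hre Him].
  replace z with (w1 * (Re (z / w1), Im (z / w1)))%C.
  - rewrite (surjective_pairing (f (w1 * (0%R, 0%R))%C)).
    rewrite (surjective_pairing (f (w1 * (Re (z / w1), Im (z / w1)))%C)).
    exact (f_equal2 pair Hre Him).
  - replace (Re (z / w1), Im (z / w1)) with (z / w1)%C
      by (apply surjective_pairing).
    field; auto.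
Qed.
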